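(* For $i=1,2$ let $\alpha_i\in[-1,1]$ and let $f_{\alpha_i}=h_{\alpha_i}+\overline{g_{\alpha_i}}\in S_H$ with $h_{\alpha_i}(z)+g_{\alpha_i}(z)=\dfrac{z(1-\alpha_i z)}{1-z^2}$. Suppose the dilatation of $f_{\alpha_1}$ is $\omega_1(z)=-z$ and let $\omega_2$ be the dilatation of $f_{\alpha_2}$. Let $0\le t\le1$ and $f=tf_{\alpha_1}+(1-t)f_{\alpha_2}$. Then: (i) if $\omega_2(z)=-z^2$ and $\alpha_1\ge\alpha_2$, then $f\in S_H$ and $f$ maps $E$ onto a domain convex in the direction of the imaginary axis; (ii) if $\omega_2(z)=z^2$, $|\alpha_1|\ge|\alpha_2|$ and $\alpha_1\alpha_2\ge0$, then $f\in S_H$ and $f$ maps $E$ onto a domain convex in the direction of the imaginary axis.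
   Context: $E=\{z\in\mathbb{C}:|z|<1\}$. For a harmonic mapping $f=h+\overline{g}$ on $E$ with $h,g$ analytic, the dilatation is $\omega=g'/h'$; $f$ is locally univalent and sense-preserving iff $h'\ne0$ and $|\omega|<1$ in $E$. $S_H$ denotes the class of harmonic, univalent, sense-preserving mappings $f=h+\overline{g}$ of $E$ normalized by $f(0)=0$, $f_z(0)=1$. A domain $\Omega$ is convex in the direction of the imaginary axis if every line parallel to the imaginary axis has connected or empty intersection with $\Omega$. *)

(* Defs.v *)
From Stdlib Require Import Reals.
Open Scope R_scope.

Definition CC : Type := (R * R)%type.
Definition Re (z : CC) : R := fst z.
Definition Im (z : CC) : R := snd z.
Definition RtoC (r : R) : CC := (r, 0).
Definition C0 : CC := (0, 0).
Definition C1 : CC := (1, 0).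
Definition Cadd (z w : CC) : CC := (fst z + fst w, snd z + snd w).
Definition Copp (z : CC) : CC := (- fst z, - snd z).
Definition Csub (z w : CC) : CC := Cadd z (Copp w).
Definition Cmul (z w : CC) : CC :=
  (fst z * fst w - snd z * snd w, fst z * snd w + snd z * fst w).
Definition Cconj (z : CC) : CC := (fst z, - snd z).
Definition Cnorm (z : CC) : R := sqrt (fst z * fst z + snd z * snd z).
Definition Cinv (z : CC) : CC :=
  let d := fst z * fst z + snd z * snd z in (fst z / d, - snd z / d).
Definition Cdiv (z w : CC) : CC := Cmul z (Cinv w).
Definition Cscale (r : R) (z : CC) : CC := (r * fst z, r * snd z).

Definition inE (z : CC) : Prop := Cnorm z < 1.

Definition has_cderiv (f : CC -> CC) (d : CC) (z : CC) : Prop :=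
  forall eps : R, 0 < eps -> exists delta : R, 0 < delta /\
    forall w : CC, Cnorm (Csub w z) < delta ->
      Cnorm (Csub (Csub (f w) (f z)) (Cmul d (Csub w z))) <= eps * Cnorm (Csub w z).

Definition analytic_on_E (f f' : CC -> CC) : Prop :=
  forall z, inE z -> has_cderiv f (f' z) z.

Definition harm (h g : CC -> CC) (z : CC) : CC := Cadd (h z) (Cconj (g z)).

Definition dilatation (h' g' : CC -> CC) (z : CC) : CC := Cdiv (g' z) (h' z).

(* f = h + conj g belongs to S_H (h, g analytic on E with derivatives h', g'):
   univalent, sense-preserving (h' <> 0 and |omega| < 1), f(0)=0, f_z(0)=h'(0)=1. *)
Definition in_SH (h g h' g' : CC -> CC) : Prop :=
  analytic_on_E h h' /\ analytic_on_E g g' /\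
  (forall z1 z2, inE z1 -> inE z2 -> harm h g z1 = harm h g z2 -> z1 = z2) /\
  (forall z, inE z -> h' z <> C0 /\ Cnorm (dilatation h' g' z) < 1) /\
  harm h g C0 = C0 /\ h' C0 = C1.

Definition convex_imag (Omega : CC -> Prop) : Prop :=
  forall w1 w2, Omega w1 -> Omega w2 -> Re w1 = Re w2 ->
    forall s : R, 0 <= s <= 1 -> Omega (Cadd w1 (Cscale s (Csub w2 w1))).

Definition image_E (f : CC -> CC) (w : CC) : Prop := exists z, inE z /\ f z = w.

Definition phi (a : R) (z : CC) : CC :=
  Cdiv (Cmul z (Csub C1 (Cmul (RtoC a) z))) (Csub C1 (Cmul z z)).

Definition comb (t : R) (u v : CC -> CC) (z : CC) : CC :=
  Cadd (Cscale t (u z)) (Cscale (1 - t) (v z)).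

(* Main.v *)
(* The combination satisfies [h + g = phi a] with [a = t a1 + (1 - t) a2].
   In the coordinate [w = (1 + z) / (1 - z) = u (1 + i k)] of the right half-plane,
   [phi a = A w - B / w + const] with [A, B >= 0], so every level set of
   [Re f = Re (phi a)] is a curve parametrized by [k], along which [Im (phi a)] increases.
   Since [Im f = Im (h - g)] and [Re ((h' - g') / (h' + g')) > 0] wherever [|g'| < |h'|],
   [Im f] increases strictly along that curve too; this gives univalence, and convexity
   in the vertical direction by the intermediate value theorem.

   There remains [|g'| < |h'|] for the combination. There [h' = M1 + M2] and
   [g' = - z (M1 + b M2)] with [b = z] in case (i) and [b = - z] in case (ii), and it is
   enough that [Re (M1 conj (M2 (1 - b))) >= 0]. Up to positive factors this is an
   expression affine in each of [a1] and [a2], so it is checked on the hypotenuse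
   [a1 = a2] and at one vertex of the triangle of admissible parameters. *)
From Coquelicot Require Import Hierarchy Derive Continuity AutoDerive.
From Coquelicot Require Complex.
From Stdlib Require Import Reals Lra Psatz.
Require Import Defs.
Open Scope R_scope.

(** * Squared moduli, norms and the derivative of a combination *)

Definition normsq (z : CC) : R := fst z * fst z + snd z * snd z.

Lemma Cnorm_normsq (z : CC) : Cnorm z = sqrt (normsq z).
Proof. reflexivity. Qed.

Lemma normsq_ge0 (z : CC) : 0 <= normsq z.
Proof. unfold normsq; nra. Qed.

Lemma normsq_neq0 (z : CC) : z <> C0 -> 0 < normsq z.
Proof.
  destruct z as [x y]; unfold normsq, C0; simpl; intros H.
  destruct (Req_dec x 0) as [-> | Hx]; [| nra].
  destruct (Req_dec y 0) as [-> | Hy]; [| nra].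
  now elim H.
Qed.

Lemma inE_normsq (z : CC) : inE z <-> normsq z < 1.
Proof.
  unfold inE; rewrite Cnorm_normsq; split; intros H.
  - rewrite <- sqrt_1 in H. now apply sqrt_lt_0_alt in H.
  - rewrite <- sqrt_1. apply sqrt_lt_1_alt. pose proof (normsq_ge0 z); lra.
Qed.

Lemma Cnorm_Cmod (z : CC) : Cnorm z = Complex.Cmod z.
Proof. unfold Cnorm, Complex.Cmod; f_equal; simpl; ring. Qed.

Lemma Cnorm_Cadd (z w : CC) : Cnorm (Cadd z w) <= Cnorm z + Cnorm w.
Proof. rewrite !Cnorm_Cmod. exact (Complex.Cmod_triangle z w). Qed.

Lemma Cnorm_Cscale (t : R) (z : CC) : 0 <= t -> Cnorm (Cscale t z) = t * Cnorm z.
Proof.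
  intros Ht. unfold Cnorm, Cscale; simpl.
  replace (t * fst z * (t * fst z) + t * snd z * (t * snd z))
    with (t * t * (fst z * fst z + snd z * snd z)) by ring.
  rewrite sqrt_mult_alt by nra. now rewrite sqrt_square.
Qed.

Lemma Rabs_fst_le_Cnorm (z : CC) : Rabs (fst z) <= Cnorm z.
Proof. rewrite <- sqrt_Rsqr_abs. apply sqrt_le_1_alt. unfold Rsqr; nra. Qed.

Lemma Rabs_snd_le_Cnorm (z : CC) : Rabs (snd z) <= Cnorm z.
Proof. rewrite <- sqrt_Rsqr_abs. apply sqrt_le_1_alt. unfold Rsqr; nra. Qed.

Lemma has_cderiv_comb (t : R) (u v : CC -> CC) (du dv z : CC) :
  0 <= t <= 1 -> has_cderiv u du z -> has_cderiv v dv z ->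
  has_cderiv (comb t u v) (Cadd (Cscale t du) (Cscale (1 - t) dv)) z.
Proof.
  intros Ht Hu Hv eps Heps.
  destruct (Hu eps Heps) as [d1 [Hd1 H1]], (Hv eps Heps) as [d2 [Hd2 H2]].
  exists (Rmin d1 d2); split; [now apply Rmin_pos|].
  intros w Hw.
  specialize (H1 w (Rlt_le_trans _ _ _ Hw (Rmin_l _ _))).
  specialize (H2 w (Rlt_le_trans _ _ _ Hw (Rmin_r _ _))).
  unfold comb.
  match goal with |- Cnorm ?X <= _ => replace X with
    (Cadd (Cscale t (Csub (Csub (u w) (u z)) (Cmul du (Csub w z))))
       (Cscale (1 - t) (Csub (Csub (v w) (v z)) (Cmul dv (Csub w z)))))
    by (unfold Cadd, Csub, Cadd, Copp, Cmul, Cscale; simpl; f_equal; ring) end.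
  eapply Rle_trans; [apply Cnorm_Cadd|].
  rewrite !Cnorm_Cscale by lra. nra.
Qed.

(** * Complex differentiable functions along real curves *)

Local Notation R2 := (prod_NormedModule R_AbsRing R_NormedModule R_NormedModule).

Lemma norm_R2 (v : CC) : @norm R_AbsRing R2 v = Cnorm v.
Proof.
  destruct v as [x y]. unfold norm; simpl. unfold prod_norm, Cnorm; simpl.
  unfold norm; simpl; unfold abs; simpl. f_equal.
  rewrite !Rmult_1_r, <- !Rabs_mult, !Rabs_pos_eq by nra. reflexivity.
Qed.

Lemma Rabs_linear_le (p q : R) (v : CC) :
  Rabs (fst v * p + snd v * q) <= (Rabs p + Rabs q + 1) * Cnorm v.
Proof.
  pose proof (Rabs_fst_le_Cnorm v); pose proof (Rabs_snd_le_Cnorm v).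
  pose proof (Rabs_pos (fst v)); pose proof (Rabs_pos p); pose proof (Rabs_pos q).
  eapply Rle_trans; [apply Rabs_triang|]. rewrite !Rabs_mult. nra.
Qed.

Lemma is_linear_R2 (p q : R) :
  is_linear (U := R2) (V := R_NormedModule) (fun v => fst v * p + snd v * q).
Proof.
  split.
  - intros [x y] [x' y']. unfold plus; simpl; unfold plus; simpl. ring.
  - intros k [x y]. unfold scal; simpl; unfold scal; simpl; unfold mult; simpl. ring.
  - exists (Rabs p + Rabs q + 1).
    split; [pose proof (Rabs_pos p); pose proof (Rabs_pos q); lra|].
    intros v. rewrite norm_R2. exact (Rabs_linear_le p q v).
Qed.

(* Meant for the two coordinates [c = fst] and [c = snd]. *)
Lemma has_cderiv_filterdiff (c : CC -> R) (p q : R) (f : CC -> CC) (d z : CC) :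
  (forall v, Rabs (c v) <= Cnorm v) ->
  (forall v w, c (Csub v w) = c v - c w) ->
  (forall v, c (Cmul d v) = fst v * p + snd v * q) ->
  has_cderiv f d z ->
  filterdiff (U := R2) (V := R_NormedModule) (fun v => c (f v)) (locally z)
    (fun v => fst v * p + snd v * q).
Proof.
  intros Hc Hsub Hl Hf. split; [apply is_linear_R2|].
  intros x Hx. pose proof (is_filter_lim_locally_unique (V := R2) _ _ Hx). subst x.
  intros eps. destruct (Hf eps (cond_pos eps)) as [delta [Hdelta H]].
  apply (locally_le_locally_norm (V := R2)).
  exists (mkposreal delta Hdelta). intros w Hw.
  unfold ball_norm in Hw. rewrite norm_R2 in Hw. rewrite norm_R2.
  refine (Rle_trans _ _ _ _ (H w Hw)).
  refine (Rle_trans _ _ _ _ (Hc _)). right.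
  rewrite !Hsub, Hl. reflexivity.
Qed.

(** A complex derivative makes each coordinate of [f] totally differentiable on the plane, so the
    two-variable chain rule applies: the velocity [(dx, dy)] is multiplied by [d]. *)
Lemma is_derive_cderiv_comp_coord (c : CC -> R) (p q : R) (f : CC -> CC) (d : CC)
    (X Y : R -> R) (k dx dy : R) :
  (forall v, Rabs (c v) <= Cnorm v) ->
  (forall v w, c (Csub v w) = c v - c w) ->
  (forall v, c (Cmul d v) = fst v * p + snd v * q) ->
  has_cderiv f d (X k, Y k) -> is_derive X k dx -> is_derive Y k dy ->
  is_derive (fun s => c (f (X s, Y s))) k (c (Cmul d (dx, dy))).
Proof.
  intros Hc Hsub Hl Hf HX HY. unfold is_derive.
  eapply filterdiff_ext_lin.
  - apply (filterdiff_comp'_2 X Y (fun x y => c (f (x, y))) k _ _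
      (fun x y => x * p + y * q) HX HY).
    eapply filterdiff_ext; cycle 1.
    + exact (has_cderiv_filterdiff c p q f d _ Hc Hsub Hl Hf).
    + now intros [x y].
  - intros y. rewrite Hl. unfold scal; simpl; unfold mult; simpl. ring.
Qed.

Lemma is_derive_cderiv_comp (f : CC -> CC) (d : CC) (X Y : R -> R) (k dx dy : R) :
  has_cderiv f d (X k, Y k) -> is_derive X k dx -> is_derive Y k dy ->
  is_derive (fun s => fst (f (X s, Y s))) k (fst (Cmul d (dx, dy))) /\
  is_derive (fun s => snd (f (X s, Y s))) k (snd (Cmul d (dx, dy))).
Proof.
  intros Hf HX HY. split.
  - apply (is_derive_cderiv_comp_coord fst (fst d) (- snd d)); auto.
    + apply Rabs_fst_le_Cnorm.
    + intros v; simpl; ring.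
  - apply (is_derive_cderiv_comp_coord snd (snd d) (fst d)); auto.
    + apply Rabs_snd_le_Cnorm.
    + intros v; simpl; ring.
Qed.

(** * Complex algebra: ring identities and cleared denominators *)

Lemma CC_ring_theory : ring_theory C0 C1 Cadd Cmul Csub Copp (@eq CC).
Proof.
  split; intros;
    repeat match goal with v : CC |- _ => destruct v end;
    unfold C0, C1, Csub, Cadd, Cmul, Copp; simpl; f_equal; ring.
Qed.
Add Ring CC_ring : CC_ring_theory.

Lemma normsq_Cmul (z w : CC) : normsq (Cmul z w) = normsq z * normsq w.
Proof. unfold normsq, Cmul; simpl; ring. Qed.

Lemma normsq_gt0_neq0 (z : CC) : 0 < normsq z -> z <> C0.
Proof. intros H ->. unfold normsq, C0 in H; simpl in H; lra. Qed.

Lemma Cmul_Cinv (z : CC) : z <> C0 -> Cmul z (Cinv z) = C1.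
Proof.
  intros H. apply normsq_neq0 in H. destruct z as [x y]. unfold normsq in H; simpl in H.
  unfold Cmul, Cinv, C1; simpl; f_equal; field; lra.
Qed.

Lemma Cdiv_eq_iff (n d q : CC) : d <> C0 -> Cdiv n d = q <-> n = Cmul q d.
Proof.
  intros Hd. unfold Cdiv. split; [intros <- | intros ->].
  - transitivity (Cmul n (Cmul d (Cinv d))); [rewrite Cmul_Cinv by exact Hd|]; ring.
  - transitivity (Cmul q (Cmul d (Cinv d))); [|rewrite Cmul_Cinv by exact Hd]; ring.
Qed.

Lemma Cmul_neq0 (z w : CC) : z <> C0 -> w <> C0 -> Cmul z w <> C0.
Proof.
  intros Hz%normsq_neq0 Hw%normsq_neq0. apply normsq_gt0_neq0.
  rewrite normsq_Cmul. now apply Rmult_lt_0_compat.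
Qed.

Lemma one_sub_neq0 (z : CC) : inE z -> Csub C1 z <> C0.
Proof.
  intros Hz%inE_normsq H. replace z with C1 in Hz.
  - unfold normsq, C1 in Hz; simpl in Hz; lra.
  - transitivity (Cadd z (Csub C1 z)); [ring | rewrite H; ring].
Qed.

Lemma inE_Cmul (z w : CC) : inE z -> inE w -> inE (Cmul z w).
Proof.
  rewrite !inE_normsq, normsq_Cmul. pose proof (normsq_ge0 z); pose proof (normsq_ge0 w).
  nra.
Qed.

Lemma inE_Copp (z : CC) : inE z -> inE (Copp z).
Proof. rewrite !inE_normsq. unfold normsq, Copp; simpl. lra. Qed.

(** Clearing the denominator [1 - z^2], nonzero on the disk, is how both the derivative of [phi] and
    its form in the half-plane coordinate are obtained. *)
Lemma phi_unique (a : R) (z v : CC) : inE z ->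
  phi a z = v <-> Cmul z (Csub C1 (Cmul (RtoC a) z)) = Cmul v (Csub C1 (Cmul z z)).
Proof. intros Hz. apply Cdiv_eq_iff, one_sub_neq0. now apply inE_Cmul. Qed.

(** * The derivative of [h + g] *)

Lemma is_derive_analytic_sum (h g h' g' : CC -> CC) (X Y : R -> R) (k dx dy : R) :
  analytic_on_E h h' -> analytic_on_E g g' -> inE (X k, Y k) ->
  is_derive X k dx -> is_derive Y k dy ->
  is_derive (fun s => fst (Cadd (h (X s, Y s)) (g (X s, Y s)))) k
    (fst (Cmul (Cadd (h' (X k, Y k)) (g' (X k, Y k))) (dx, dy))) /\
  is_derive (fun s => snd (Cadd (h (X s, Y s)) (g (X s, Y s)))) k
    (snd (Cmul (Cadd (h' (X k, Y k)) (g' (X k, Y k))) (dx, dy))).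
Proof.
  intros Hh Hg Hin HX HY.
  destruct (is_derive_cderiv_comp h _ X Y k dx dy (Hh _ Hin) HX HY) as [Hh1 Hh2].
  destruct (is_derive_cderiv_comp g _ X Y k dx dy (Hg _ Hin) HX HY) as [Hg1 Hg2].
  split.
  - replace (fst (Cmul _ _)) with
      (fst (Cmul (h' (X k, Y k)) (dx, dy)) + fst (Cmul (g' (X k, Y k)) (dx, dy)))
      by (simpl; ring).
    exact (is_derive_plus (V := R_NormedModule) _ _ _ _ _ Hh1 Hg1).
  - replace (snd (Cmul _ _)) with
      (snd (Cmul (h' (X k, Y k)) (dx, dy)) + snd (Cmul (g' (X k, Y k)) (dx, dy)))
      by (simpl; ring).
    exact (is_derive_plus (V := R_NormedModule) _ _ _ _ _ Hh2 Hg2).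
Qed.

Lemma inE_horizontal_nbhd (x y : R) : inE (x, y) -> locally x (fun s => inE (s, y)).
Proof.
  intros H%inE_normsq.
  assert (Hc : continuous (fun s => s * s + y * y) x)
    by (apply (ex_derive_continuous (V := R_NormedModule)); auto_derive; exact I).
  apply (filter_imp (fun s => s * s + y * y < 1)).
  - intros s Hs. now apply inE_normsq.
  - exact (Hc (fun u => u < 1) (open_lt 1 _ H)).
Qed.

(** The numerator of the derivative of [phi a] over the denominator [(1 - z^2)^2]. *)
Definition phi_num (a : R) (z : CC) : CC :=
  Cadd (Csub C1 (Cmul (RtoC (2 * a)) z)) (Cmul z z).

(* Differentiates [z (1 - a z) = S (1 - z^2)] along a horizontal line. *)
Lemma phi_deriv_horizontal (a x y d1 d2 : R) (S1 S2 : R -> R) :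
  is_derive S1 x d1 -> is_derive S2 x d2 ->
  locally x (fun s => Cmul (s, y) (Csub C1 (Cmul (RtoC a) (s, y)))
                      = Cmul (S1 s, S2 s) (Csub C1 (Cmul (s, y) (s, y)))) ->
  Cmul (d1, d2) (Cmul (Csub C1 (Cmul (x, y) (x, y))) (Csub C1 (Cmul (x, y) (x, y))))
    = phi_num a (x, y).
Proof.
  intros H1 H2 Heq.
  assert (E1 : is_derive (fun s => fst (Cmul (S1 s, S2 s) (Csub C1 (Cmul (s, y) (s, y))))) x
     (1 - 2 * a * x)).
  { apply (is_derive_ext_loc (fun s => fst (Cmul (s, y) (Csub C1 (Cmul (RtoC a) (s, y)))))).
    - revert Heq. apply filter_imp. intros s Hs. exact (f_equal fst Hs).
    - simpl. auto_derive; auto. ring. }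
  assert (E2 : is_derive (fun s => snd (Cmul (S1 s, S2 s) (Csub C1 (Cmul (s, y) (s, y))))) x
     (- 2 * a * y)).
  { apply (is_derive_ext_loc (fun s => snd (Cmul (s, y) (Csub C1 (Cmul (RtoC a) (s, y)))))).
    - revert Heq. apply filter_imp. intros s Hs. exact (f_equal snd Hs).
    - simpl. auto_derive; auto. ring. }
  assert (Hx : Cmul (x, y) (Csub C1 (Cmul (RtoC a) (x, y)))
               = Cmul (S1 x, S2 x) (Csub C1 (Cmul (x, y) (x, y))))
    by exact (locally_singleton _ _ Heq).
  apply is_derive_unique in E1. apply is_derive_unique in E2.
  simpl in E1, E2.
  assert (X1 : ex_derive S1 x) by (eexists; exact H1).
  assert (X2 : ex_derive S2 x) by (eexists; exact H2).
  apply is_derive_unique in H1. apply is_derive_unique in H2.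
  rewrite (is_derive_unique _ _ (d1 * (1 - x * x + y * y) - 2 * x * S1 x
     + 2 * y * S2 x + 2 * x * y * d2)) in E1.
  2:{ auto_derive; [auto|].
      change (Derive (fun u => S1 u) x) with (Derive S1 x).
      change (Derive (fun u => S2 u) x) with (Derive S2 x).
      rewrite H1, H2. ring. }
  rewrite (is_derive_unique _ _ (d2 * (1 - x * x + y * y) - 2 * x * S2 x
     - 2 * y * S1 x - 2 * x * y * d1)) in E2.
  2:{ auto_derive; [auto|].
      change (Derive (fun u => S1 u) x) with (Derive S1 x).
      change (Derive (fun u => S2 u) x) with (Derive S2 x).
      rewrite H1, H2. ring. }
  (* With [D = (d1, d2)] and [S = (S1, S2)], the differentiated identity reads
     [D (1 - z^2) - 2 z S = 1 - 2 a z]. After multiplication by [1 - z^2], the original identity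
     eliminates [S]. *)
  assert (Hd : Csub (Cmul (d1, d2) (Csub C1 (Cmul (x, y) (x, y))))
       (Cmul (RtoC 2) (Cmul (x, y) (S1 x, S2 x)))
     = Csub C1 (Cmul (RtoC (2 * a)) (x, y)))
    by (unfold Csub, Cadd, Cmul, Copp, RtoC, C1; simpl; f_equal; lra).
  unfold phi_num.
  transitivity (Cadd (Cmul (Csub (Cmul (d1, d2) (Csub C1 (Cmul (x, y) (x, y))))
       (Cmul (RtoC 2) (Cmul (x, y) (S1 x, S2 x)))) (Csub C1 (Cmul (x, y) (x, y))))
     (Cmul (RtoC 2) (Cmul (x, y) (Cmul (S1 x, S2 x) (Csub C1 (Cmul (x, y) (x, y)))))));
    [ring|].
  rewrite Hd, <- Hx.
  unfold Csub, Cadd, Cmul, Copp, RtoC, C1; simpl. f_equal; ring.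
Qed.

(** The complex derivative of [h + g] exists, so its value can be read off in the single direction
    [(1, 0)]. *)
Lemma phi_deriv (a : R) (h g h' g' : CC -> CC) (z : CC) :
  analytic_on_E h h' -> analytic_on_E g g' ->
  (forall v, inE v -> Cadd (h v) (g v) = phi a v) -> inE z ->
  Cmul (Cadd (h' z) (g' z)) (Cmul (Csub C1 (Cmul z z)) (Csub C1 (Cmul z z)))
    = phi_num a z.
Proof.
  intros Hh Hg Hsum Hz. destruct z as [x y].
  assert (Hx : is_derive (fun s : R => s) x 1) by (auto_derive; auto).
  assert (Hy : is_derive (fun _ : R => y) x 0) by (auto_derive; auto).
  destruct (is_derive_analytic_sum h g h' g' _ _ x _ _ Hh Hg Hz Hx Hy) as [H1 H2].
  rewrite <- (phi_deriv_horizontal a x y _ _ _ _ H1 H2).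
  - f_equal. rewrite <- surjective_pairing.
    transitivity (Cmul (Cadd (h' (x, y)) (g' (x, y))) C1); [ring | reflexivity].
  - apply (filter_imp (fun s => inE (s, y))); [|now apply inE_horizontal_nbhd].
    intros s Hs. rewrite <- surjective_pairing. apply phi_unique; auto. symmetry; auto.
Qed.

(** * The half-plane coordinate *)

(* The point [(w - 1) / (w + 1)] for [w = u (1 + i k)]. *)
Definition cayley (u k : R) : CC :=
  ((u * u * (1 + k * k) - 1) / ((u + 1) * (u + 1) + u * u * (k * k)),
   2 * u * k / ((u + 1) * (u + 1) + u * u * (k * k))).

Lemma cayley_inE (u k : R) : 0 < u -> inE (cayley u k).
Proof.
  intros Hu. apply inE_normsq. unfold normsq, cayley; simpl.
  set (d := (u + 1) * (u + 1) + u * u * (k * k)).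
  assert (Hd : 0 < d) by (unfold d; nra).
  replace (_ + _) with (1 - 4 * u / d) by (unfold d; field; fold d; lra).
  assert (0 < 4 * u / d) by (apply Rdiv_lt_0_compat; lra). lra.
Qed.

Lemma cayley_surj (z : CC) : inE z -> exists u k, 0 < u /\ z = cayley u k.
Proof.
  intros H%inE_normsq. destruct z as [x y]. unfold normsq in H; simpl in H.
  assert (Hx : 0 < (1 - x) * (1 - x) + y * y) by nra.
  (* These are [Re w] and [Im w / Re w] for [w = (1 + z) / (1 - z)]. *)
  exists ((1 - x * x - y * y) / ((1 - x) * (1 - x) + y * y)), (2 * y / (1 - x * x - y * y)).
  split; [apply Rdiv_lt_0_compat; lra|].
  set (u := (1 - x * x - y * y) / _). set (k := 2 * y / _).
  assert (Hk : u * k = 2 * y / ((1 - x) * (1 - x) + y * y))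
    by (unfold u, k; field; split; lra).
  assert (Hden : (u + 1) * (u + 1) + u * u * (k * k) = 4 / ((1 - x) * (1 - x) + y * y)).
  { replace (u * u * (k * k)) with ((u * k) * (u * k)) by ring. rewrite Hk.
    unfold u. field. lra. }
  assert (Hnum : u * u * (1 + k * k) - 1 = 4 * x / ((1 - x) * (1 - x) + y * y)).
  { replace (u * u * (1 + k * k)) with (u * u + (u * k) * (u * k)) by ring. rewrite Hk.
    unfold u. field. lra. }
  unfold cayley. rewrite Hden, Hnum.
  replace (2 * u * k) with (2 * (u * k)) by ring. rewrite Hk.
  f_equal; field; lra.
Qed.

(* With [w = u (1 + i k)], [phi a] becomes [(1 - a) / 4 * w - (1 + a) / 4 / w + a / 2]. *)
Lemma phi_cayley (a u k : R) : 0 < u ->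
  phi a (cayley u k) =
  ((1 - a) / 4 * u - (1 + a) / 4 / (u * (1 + k * k)) + a / 2,
   k * ((1 - a) / 4 * u + (1 + a) / 4 / (u * (1 + k * k)))).
Proof.
  intros Hu. apply phi_unique; [now apply cayley_inE|].
  assert (0 < 1 + k * k) by nra.
  assert (0 < (u + 1) * (u + 1) + u * u * (k * k)) by nra.
  unfold cayley, Csub, Cadd, Cmul, Copp, RtoC, C1; simpl.
  f_equal; field; repeat split; lra.
Qed.

(** * Level curves of the real part of [A w - B / w] *)

Section LevelCurve.
Variables A B c : R.
Hypothesis HA : 0 <= A.
Hypothesis HB : 0 <= B.
Hypothesis HAB : 0 < A + B.

(** For fixed [k] the expression is strictly increasing in [u]: after clearing denominators, the
    difference of two values is [u - v] times a positive factor. *)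
Lemma level_unique (k u v : R) : 0 < u -> 0 < v ->
  A * u - B / (u * (1 + k * k)) = c -> A * v - B / (v * (1 + k * k)) = c -> u = v.
Proof.
  intros Hu Hv Eu Ev.
  assert (Hk : 0 < 1 + k * k) by nra.
  assert (H : (u - v) * (A * (u * v * (1 + k * k)) + B) = 0).
  { transitivity ((A * u - B / (u * (1 + k * k)) - (A * v - B / (v * (1 + k * k))))
       * (u * v * (1 + k * k))); [field; lra|]. rewrite Eu, Ev. ring. }
  assert (Huv : 0 < u * v * (1 + k * k)) by (repeat apply Rmult_lt_0_compat; lra).
  apply Rmult_integral in H. destruct H as [H | H]; [lra|].
  exfalso. destruct (Req_dec A 0) as [-> | HA']; nra.
Qed.

(** This is [(p + q)^2 = (p - q)^2 + 4 p q], where the product [p q] is free of [u]. Hence on a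
    level curve [p + q] is an explicit function of [k] alone. *)
Lemma level_sum_sqr (u k : R) : 0 < u ->
  (A * u + B / (u * (1 + k * k))) * (A * u + B / (u * (1 + k * k))) =
  (A * u - B / (u * (1 + k * k))) * (A * u - B / (u * (1 + k * k)))
  + 4 * A * B / (1 + k * k).
Proof. intros Hu. field. split; nra. Qed.

Lemma level_sum_gt0 (u k : R) : 0 < u -> 0 < A * u + B / (u * (1 + k * k)).
Proof.
  intros Hu. assert (Hk : 0 < u * (1 + k * k)) by nra.
  replace (_ + _) with ((A * (u * (u * (1 + k * k))) + B) / (u * (1 + k * k)))
    by (field; nra).
  apply Rdiv_lt_0_compat; [|exact Hk].
  assert (0 < u * (u * (1 + k * k))) by (now apply Rmult_lt_0_compat).
  destruct (Req_dec A 0) as [-> | HA']; nra.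
Qed.

Lemma level_sum_eq (u k : R) : 0 < u -> A * u - B / (u * (1 + k * k)) = c ->
  A * u + B / (u * (1 + k * k)) = sqrt (c * c + 4 * A * B / (1 + k * k)).
Proof.
  intros Hu Hc. rewrite <- Hc, <- level_sum_sqr by exact Hu.
  rewrite sqrt_square; [reflexivity|]. now apply Rlt_le, level_sum_gt0.
Qed.

Variables u0 k0 : R.
Hypothesis Hu0 : 0 < u0.
Hypothesis Hc0 : A * u0 - B / (u0 * (1 + k0 * k0)) = c.

(** If [A B = 0], the expression is the constant [c^2], which is positive because at the given point
    [(u0, k0)] it is the square of a positive sum. Otherwise the second term is positive. *)
Lemma level_disc_gt0 (k : R) : 0 < c * c + 4 * A * B / (1 + k * k).
Proof.
  pose proof (level_sum_sqr u0 k0 Hu0) as H. pose proof (level_sum_gt0 u0 k0 Hu0) as H'.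
  rewrite Hc0 in H. assert (Hk : 0 < 1 + k * k) by nra. assert (Hk0 : 0 < 1 + k0 * k0) by nra.
  assert (HP : 0 <= 4 * A * B) by nra.
  destruct (Req_dec (4 * A * B) 0) as [E | E].
  - rewrite E in *. unfold Rdiv in *. rewrite Rmult_0_l in *. nra.
  - assert (0 < 4 * A * B / (1 + k * k)) by (apply Rdiv_lt_0_compat; lra). nra.
Qed.

(** For [A > 0], [U k] is the positive root of [A u^2 - c u - B / (1 + k^2) = 0]; for [A = 0] the
    equation is linear and the given point forces [c < 0]. *)
Lemma level_curve : exists U : R -> R,
  (forall k, ex_derive U k) /\ (forall k, 0 < U k) /\
  (forall k, A * U k - B / (U k * (1 + k * k)) = c).
Proof.
  destruct (Req_dec A 0) as [HA0 | HA0].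
  - assert (Hc : c < 0).
    { assert (0 < B / (u0 * (1 + k0 * k0))) by (apply Rdiv_lt_0_compat; nra). nra. }
    exists (fun k => B / (- c * (1 + k * k))). repeat split; intros k.
    + auto_derive. nra.
    + apply Rdiv_lt_0_compat; nra.
    + rewrite HA0. field. repeat split; nra.
  - assert (HA' : 0 < A) by lra.
    set (s := fun k => sqrt (c * c + 4 * A * B / (1 + k * k))).
    assert (Hss : forall k, s k * s k = c * c + 4 * A * B / (1 + k * k))
      by (intros k; apply sqrt_sqrt, Rlt_le, level_disc_gt0).
    (* If [B = 0] then [c = A u0 > 0]; otherwise [s k] exceeds the absolute value of [c]. *)
    assert (Hpos : forall k, 0 < c + s k).
    { intros k. assert (Hs : 0 <= s k) by apply sqrt_pos. specialize (Hss k).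
      assert (Hk : 0 < 1 + k * k) by nra.
      destruct (Req_dec B 0) as [HB0 | HB0].
      - rewrite HB0 in Hc0. unfold Rdiv in Hc0. rewrite Rmult_0_l in Hc0. nra.
      - assert (0 < 4 * A * B / (1 + k * k)) by (apply Rdiv_lt_0_compat; nra). nra. }
    exists (fun k => (c + s k) / (2 * A)). repeat split; intros k.
    + unfold s. pose proof (level_disc_gt0 k). auto_derive. repeat split; try nra.
    + apply Rdiv_lt_0_compat; [apply Hpos | lra].
    + specialize (Hss k). specialize (Hpos k). assert (Hk : 0 < 1 + k * k) by nra.
      assert (E : 4 * A * B / (1 + k * k) = (s k - c) * (c + s k)).
      { replace ((s k - c) * (c + s k)) with (s k * s k - c * c) by ring. lra. }
      replace (B / ((c + s k) / (2 * A) * (1 + k * k)))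
        with (4 * A * B / (1 + k * k) / (2 * (c + s k))) by (field; repeat split; lra).
      rewrite E. field. split; lra.
Qed.

Lemma level_height_deriv (k : R) : exists y' : R, 0 < y' /\
  is_derive (fun k => k * sqrt (c * c + 4 * A * B / (1 + k * k))) k y'.
Proof.
  pose proof (level_disc_gt0 k) as H.
  assert (Hk : 0 < 1 + k * k) by nra.
  set (s := sqrt (c * c + 4 * A * B / (1 + k * k))).
  assert (Hs : 0 < s) by now apply sqrt_lt_R0.
  assert (Hss : s * s = c * c + 4 * A * B / (1 + k * k)) by (apply sqrt_sqrt; lra).
  (* This is [s + k s'], where [s s' = - 4 A B k / (1 + k^2)^2]; inserting the value of [s^2] leaves
     a sum of nonnegative terms over [s]. *)
  exists ((c * c + 4 * A * B / ((1 + k * k) * (1 + k * k))) / s). split.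
  - apply Rdiv_lt_0_compat; [|exact Hs].
    assert (0 <= 4 * A * B / ((1 + k * k) * (1 + k * k)))
      by (apply Rmult_le_pos; [nra | apply Rlt_le, Rinv_0_lt_compat; nra]).
    destruct (Req_dec c 0) as [E | E]; [|nra].
    rewrite E in H |- *. rewrite Rmult_0_l, Rplus_0_l in H |- *.
    replace (4 * A * B / ((1 + k * k) * (1 + k * k)))
      with (4 * A * B / (1 + k * k) * / (1 + k * k)) by (field; lra).
    apply Rmult_lt_0_compat; [exact H | now apply Rinv_0_lt_compat].
  - auto_derive; [repeat split; [lra | exact H]|].
    change (sqrt (c * c + 4 * A * B * / (1 + k * k))) with s.
    replace (c * c + 4 * A * B / ((1 + k * k) * (1 + k * k)))
      with (s * s - 4 * A * B / (1 + k * k) + 4 * A * B / ((1 + k * k) * (1 + k * k)))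
      by (rewrite Hss; ring).
    field. lra.
Qed.

End LevelCurve.

(** * Univalence and vertical convexity by shearing *)

Lemma ex_derive_cayley (U : R -> R) (k : R) : 0 < U k -> ex_derive U k ->
  ex_derive (fun s => fst (cayley (U s) s)) k /\
  ex_derive (fun s => snd (cayley (U s) s)) k.
Proof.
  intros Hu HU. assert (0 < (U k + 1) * (U k + 1) + U k * U k * (k * k)) by nra.
  unfold cayley; simpl. split; auto_derive; repeat split; auto; lra.
Qed.

(* For [a = p v] and [b = q v] with [Re (a + b) = 0], the product
   [Im (a + b) Im (a - b)] equals [Re ((a + b) conj (a - b)) = |a|^2 - |b|^2]. *)
Lemma vertical_sum_diff (p q v : CC) (y : R) :
  0 < y -> fst (Cmul (Cadd p q) v) = 0 -> snd (Cmul (Cadd p q) v) = y ->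
  normsq q < normsq p -> 0 < snd (Cmul p v) - snd (Cmul q v).
Proof.
  intros Hy H1 H2 Hqp.
  assert (Hv : 0 < normsq v).
  { apply normsq_neq0. intros ->. unfold Cmul, C0 in H2; simpl in H2. lra. }
  apply Rmult_lt_reg_l with y; [exact Hy|]. rewrite Rmult_0_r.
  replace (y * (snd (Cmul p v) - snd (Cmul q v)))
    with ((normsq p - normsq q) * normsq v).
  - apply Rmult_lt_0_compat; lra.
  - rewrite Rmult_minus_distr_r, <- !normsq_Cmul, <- H2.
    assert (E : fst (Cmul p v) = - fst (Cmul q v)) by (simpl in *; lra).
    replace (snd (Cmul (Cadd p q) v)) with (snd (Cmul p v) + snd (Cmul q v))
      by (simpl; ring).
    unfold normsq. rewrite E. ring.
Qed.

(** One parametrization [Z] exhausts the level set of [Re f] through [z0], so injectivity and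
    convexity both become statements about one real function of [k]: the first uses its strict
    growth, the second its continuity. *)
Lemma shear_curve (a : R) (h g h' g' : CC -> CC) (z0 : CC) :
  -1 <= a <= 1 -> analytic_on_E h h' -> analytic_on_E g g' ->
  (forall z, inE z -> Cadd (h z) (g z) = phi a z) ->
  (forall z, inE z -> normsq (g' z) < normsq (h' z)) -> inE z0 ->
  exists (Z : R -> CC) (dP : R -> R),
    (forall k, inE (Z k) /\ fst (harm h g (Z k)) = fst (harm h g z0)) /\
    (forall z, inE z -> fst (harm h g z) = fst (harm h g z0) -> exists k, z = Z k) /\
    (forall k, is_derive (fun s => snd (harm h g (Z s))) k (dP k) /\ 0 < dP k).
Proof.
  intros Ha Hh Hg Hsum Hlt Hz0.
  destruct (cayley_surj z0 Hz0) as (u0 & k0 & Hu0 & Ez0).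
  set (A := (1 - a) / 4). set (B := (1 + a) / 4).
  assert (HA : 0 <= A) by (unfold A; lra). assert (HB : 0 <= B) by (unfold B; lra).
  assert (HAB : 0 < A + B) by (unfold A, B; lra).
  assert (Hphi : forall u k, 0 < u -> Cadd (h (cayley u k)) (g (cayley u k)) =
    (A * u - B / (u * (1 + k * k)) + a / 2, k * (A * u + B / (u * (1 + k * k))))).
  { intros u k Hu. rewrite Hsum by now apply cayley_inE. now apply phi_cayley. }
  set (c := A * u0 - B / (u0 * (1 + k0 * k0))).
  destruct (level_curve A B c HA HB HAB u0 k0 Hu0 eq_refl) as (U & HU & HU0 & HUc).
  assert (Hre : forall z, fst (harm h g z) = fst (Cadd (h z) (g z))) by reflexivity.
  assert (Hder : forall k, exists p, is_derive (fun s => snd (harm h g (cayley (U s) s))) k p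
                              /\ 0 < p).
  { intros k.
    destruct (ex_derive_cayley U k (HU0 k) (HU k)) as [[dx Hx] [dy Hy]].
    pose (X := fun s => fst (cayley (U s) s)). pose (Y := fun s => snd (cayley (U s) s)).
    assert (Hin : inE (X k, Y k)) by exact (cayley_inE (U k) k (HU0 k)).
    destruct (level_height_deriv A B c HA HB HAB u0 k0 Hu0 eq_refl k) as (y' & Hy' & HY).
    destruct (is_derive_analytic_sum h g h' g' X Y k dx dy Hh Hg Hin Hx Hy) as [H1 H2].
    destruct (is_derive_cderiv_comp h _ X Y k dx dy (Hh _ Hin) Hx Hy) as [_ Hh2].
    destruct (is_derive_cderiv_comp g _ X Y k dx dy (Hg _ Hin) Hx Hy) as [_ Hg2].
    exists (snd (Cmul (h' (X k, Y k)) (dx, dy)) - snd (Cmul (g' (X k, Y k)) (dx, dy))).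
    split; [exact (is_derive_minus (V := R_NormedModule) _ _ _ _ _ Hh2 Hg2)|].
    apply vertical_sum_diff with y'; [exact Hy' | | | now apply Hlt].
    (* Along the curve [h + g] has constant real part [c + a / 2] and imaginary part
       [k sqrt (c^2 + 4 A B / (1 + k^2))]. Uniqueness of derivatives transfers this to [h' + g']
       times the tangent vector [(dx, dy)]. *)
    - transitivity (Derive (fun _ : R => c + a / 2) k); [symmetry | apply Derive_const].
      apply is_derive_unique.
      refine (is_derive_ext _ _ _ _ _ H1).
      intros s. change (X s, Y s) with (cayley (U s) s).
      rewrite Hphi by apply HU0. simpl. rewrite HUc. reflexivity.
    - apply is_derive_unique in HY. rewrite <- HY. symmetry. apply is_derive_unique.
      refine (is_derive_ext _ _ _ _ _ H2).
      intros s. change (X s, Y s) with (cayley (U s) s).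
      rewrite Hphi by apply HU0. simpl.
      now rewrite (level_sum_eq A B c HA HB HAB (U s) s (HU0 s) (HUc s)). }
  exists (fun k => cayley (U k) k), (fun k => Derive (fun s => snd (harm h g (cayley (U s) s))) k).
  split; [|split].
  - intros k. split; [now apply cayley_inE|].
    rewrite !Hre, Ez0, !Hphi by auto. simpl. now rewrite HUc.
  - intros z Hz. destruct (cayley_surj z Hz) as (u & k & Hu & ->).
    rewrite !Hre, Ez0, !Hphi by auto. simpl. fold c. intros E. exists k. f_equal.
    apply (level_unique A B c HA HB HAB k); auto. lra.
  - intros k. destruct (Hder k) as (p & Hp & Hp0).
    split; [apply Derive_correct; now exists p|].
    exact (eq_ind_r (fun r => 0 < r) Hp0 (is_derive_unique _ _ _ Hp)).
Qed.

Lemma shear_injective (a : R) (h g h' g' : CC -> CC) :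
  -1 <= a <= 1 -> analytic_on_E h h' -> analytic_on_E g g' ->
  (forall z, inE z -> Cadd (h z) (g z) = phi a z) ->
  (forall z, inE z -> normsq (g' z) < normsq (h' z)) ->
  forall z1 z2, inE z1 -> inE z2 -> harm h g z1 = harm h g z2 -> z1 = z2.
Proof.
  intros Ha Hh Hg Hsum Hlt z1 z2 Hz1 Hz2 E.
  destruct (shear_curve a h g h' g' z2 Ha Hh Hg Hsum Hlt Hz2) as (Z & dP & HZ & Hex & Hder).
  destruct (Hex z1 Hz1 (f_equal fst E)) as [k1 ->].
  destruct (Hex z2 Hz2 eq_refl) as [k2 ->].
  assert (Hmono : forall x y, x < y -> snd (harm h g (Z x)) < snd (harm h g (Z y))).
  { intros x y Hxy.
    apply (incr_function (fun s => snd (harm h g (Z s))) Rbar.m_infty Rbar.p_infty dP);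
      simpl; auto.
    - intros s _ _. apply Hder.
    - intros s _ _. apply Hder. }
  apply (f_equal snd) in E.
  destruct (Rtotal_order k1 k2) as [H | [-> | H]]; [| reflexivity |];
    apply Hmono in H; lra.
Qed.

Lemma shear_convex_imag (a : R) (h g h' g' : CC -> CC) :
  -1 <= a <= 1 -> analytic_on_E h h' -> analytic_on_E g g' ->
  (forall z, inE z -> Cadd (h z) (g z) = phi a z) ->
  (forall z, inE z -> normsq (g' z) < normsq (h' z)) ->
  convex_imag (image_E (harm h g)).
Proof.
  intros Ha Hh Hg Hsum Hlt w1 w2 [z1 [Hz1 E1]] [z2 [Hz2 E2]] Ere s Hs.
  destruct (shear_curve a h g h' g' z1 Ha Hh Hg Hsum Hlt Hz1) as (Z & dP & HZ & Hex & Hder).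
  destruct (Hex z1 Hz1 eq_refl) as [k1 Ek1].
  destruct (Hex z2 Hz2) as [k2 Ek2]; [rewrite E1, E2; symmetry; exact Ere|].
  set (P := fun k => snd (harm h g (Z k))).
  destruct (IVT_gen P k1 k2 (P k1 + s * (P k2 - P k1))) as (k & _ & Hk).
  - intros k. apply continuity_pt_filterlim.
    apply (ex_derive_continuous (V := R_NormedModule)). exists (dP k). apply Hder.
  - unfold Rmin, Rmax. destruct (Rle_dec (P k1) (P k2)); nra.
  - exists (Z k). split; [apply HZ|].
    unfold P in Hk. rewrite <- Ek1, <- Ek2, E1, E2 in Hk.
    rewrite (surjective_pairing (harm h g (Z k))), Hk.
    rewrite (proj2 (HZ k)), E1. unfold Re in Ere.
    unfold Cadd, Cscale, Csub, Cadd, Copp; simpl. f_equal. rewrite Ere. ring.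
Qed.

(** * The dilatation of a combination *)

Lemma dilatation_eq (h' g' : CC -> CC) (z q : CC) : h' z <> C0 ->
  dilatation h' g' z = q -> g' z = Cmul q (h' z).
Proof. intros Hh. now apply Cdiv_eq_iff. Qed.

(** The strict comparison of squared moduli already contains [h' z <> 0] and avoids dividing by a
    combination not yet known to be nonzero. *)
Lemma dilatation_lt1 (h' g' : CC -> CC) (z : CC) :
  (h' z <> C0 /\ Cnorm (dilatation h' g' z) < 1) <-> normsq (g' z) < normsq (h' z).
Proof.
  split.
  - intros [H0 H]. apply inE_normsq in H.
    rewrite (dilatation_eq h' g' z _ H0 eq_refl), normsq_Cmul.
    pose proof (normsq_neq0 _ H0). nra.
  - intros H. pose proof (normsq_ge0 (g' z)).
    assert (Hh : h' z <> C0) by (apply normsq_gt0_neq0; lra).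
    split; [exact Hh|]. apply inE_normsq.
    rewrite (dilatation_eq h' g' z _ Hh eq_refl), normsq_Cmul in H.
    pose proof (normsq_ge0 (h' z)). pose proof (normsq_neq0 _ Hh). nra.
Qed.

(* [|M1 + M2|^2 - |M1 + b M2|^2 = (1 - |b|^2) |M2|^2 + 2 Re (M1 conj (M2 (1 - b)))]. *)
Lemma combined_dilatation_lt1 (t : R) (z b p1 p2 : CC) :
  0 <= t <= 1 -> inE z -> inE b -> p1 <> C0 -> p2 <> C0 ->
  0 <= fst (Cmul p1 (Cconj (Cmul p2 (Csub C1 b)))) ->
  normsq (Cmul z (Cadd (Cscale t p1) (Cscale (1 - t) (Cmul b p2))))
  < normsq (Cadd (Cscale t p1) (Cscale (1 - t) p2)).
Proof.
  intros Ht Hz%inE_normsq Hb%inE_normsq Hp1%normsq_neq0 Hp2%normsq_neq0 Hcross.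
  rewrite normsq_Cmul.
  set (v := Cadd (Cscale t p1) (Cscale (1 - t) (Cmul b p2))).
  assert (E : normsq (Cadd (Cscale t p1) (Cscale (1 - t) p2)) =
    normsq v + (1 - normsq b) * ((1 - t) * (1 - t) * normsq p2)
    + 2 * (t * (1 - t)) * fst (Cmul p1 (Cconj (Cmul p2 (Csub C1 b))))).
  { unfold v, normsq, Cadd, Cscale, Cconj, Csub, Copp, Cmul, C1, Cadd; simpl. ring. }
  assert (0 <= t * (1 - t)) by nra.
  assert (0 <= 2 * (t * (1 - t)) * fst (Cmul p1 (Cconj (Cmul p2 (Csub C1 b)))))
    by (apply Rmult_le_pos; lra).
  pose proof (normsq_ge0 v).
  (* At [t = 1] strictness comes only from [|z| < 1] and [p1 <> 0]; for [t < 1] the term with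
     [|p2|^2] is positive. *)
  destruct (Req_dec t 1) as [-> | Ht1].
  - assert (Ev : normsq v = normsq p1).
    { unfold v, normsq, Cadd, Cscale, Cmul; simpl. ring. }
    rewrite E. nra.
  - assert (0 < (1 - t) * (1 - t) * normsq p2).
    { apply Rmult_lt_0_compat; [|exact Hp2]. assert (0 < 1 - t) by lra. nra. }
    assert (0 < (1 - normsq b) * ((1 - t) * (1 - t) * normsq p2))
      by (apply Rmult_lt_0_compat; lra).
    rewrite E. nra.
Qed.

(* With [X = d1 e1], both [Re] differ by the factor [|X|^2]. *)
Lemma cross_term_ge0 (p1 p2 d1 d2 e1 e2 c : CC) :
  Cmul d1 e1 <> C0 -> Cmul d2 e2 = Cmul (Cmul d1 e1) c ->
  0 <= fst (Cmul (Cmul (Cmul p1 d1) e1) (Cconj (Cmul (Cmul p2 d2) e2))) ->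
  0 <= fst (Cmul p1 (Cconj (Cmul p2 c))).
Proof.
  intros HX%normsq_neq0 E H.
  apply Rmult_le_reg_l with (normsq (Cmul d1 e1)); [exact HX|]. rewrite Rmult_0_r.
  replace (Cmul (Cmul p2 d2) e2) with (Cmul p2 (Cmul d2 e2)) in H by ring.
  replace (Cmul (Cmul p1 d1) e1) with (Cmul p1 (Cmul d1 e1)) in H by ring.
  rewrite E in H. eapply Rle_trans; [exact H|]. right.
  generalize (Cmul d1 e1). intros X. unfold normsq, Cmul, Cconj; simpl. ring.
Qed.

(** * Nonnegativity of the cross term *)

(* The two identities express that [F] is affine in its second, resp. first, variable:
   linear interpolation between [l] and [1], resp. between [b] and [1]. *)
Lemma biaffine_ge0 (F : R -> R -> R) (l a b : R) :
  (forall b, (1 - l) * F 1 b = (b - l) * F 1 1 + (1 - b) * F 1 l) ->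
  (forall a b, (1 - b) * F a b = (a - b) * F 1 b + (1 - a) * F b b) ->
  (forall a, 0 <= F a a) -> 0 <= F 1 l -> l < 1 -> l <= b <= a -> a <= 1 -> 0 <= F a b.
Proof.
  intros H1 H2 Hd Hv Hl Hb Ha.
  destruct (Req_dec b 1) as [-> | Hb1].
  - replace a with 1 by lra. apply Hd.
  - assert (H1b : 0 <= F 1 b).
    { apply Rmult_le_reg_l with (1 - l); [lra|]. rewrite Rmult_0_r, H1.
      apply Rplus_le_le_0_compat; apply Rmult_le_pos; auto; lra. }
    apply Rmult_le_reg_l with (1 - b); [lra|]. rewrite Rmult_0_r, H2.
    apply Rplus_le_le_0_compat; apply Rmult_le_pos; auto; lra.
Qed.

Lemma phi_num_pair (a x y : R) :
  phi_num a (x, y) = (1 - 2 * a * x + x * x - y * y, 2 * y * (x - a)).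
Proof. unfold phi_num, Csub, Cadd, Cmul, Copp, RtoC, C1; simpl; f_equal; ring. Qed.

(** Write [N1], [N2] for the two numerators. Since [Im (N1 conj N2) = - 2 y (a1 - a2) (1 - |z|^2)]
    and [(1 + z) conj (1 - z) = 1 - |z|^2 + 2 i y], a factor [1 - |z|^2] splits off and leaves [F].
    On the diagonal [F] is a squared modulus; the remaining vertex is [(1, -1)]. *)
Lemma phi_num_cross1 (a1 a2 : R) (z : CC) :
  -1 <= a2 <= a1 -> a1 <= 1 -> inE z ->
  0 <= fst (Cmul (Cmul (phi_num a1 z) (Cadd C1 z))
                 (Cconj (Cmul (phi_num a2 z) (Csub C1 z)))).
Proof.
  intros H2 H1 Hz%inE_normsq. destruct z as [x y]. rewrite !phi_num_pair.
  unfold normsq in Hz; simpl in Hz.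
  pose (F := fun a b => (1 - 2 * a * x + x * x - y * y) * (1 - 2 * b * x + x * x - y * y)
    + 2 * y * (x - a) * (2 * y * (x - b)) + 4 * (y * y) * (a - b)).
  assert (HF : 0 <= F a1 a2).
  { apply (biaffine_ge0 F (-1)); auto; try lra; unfold F.
    - intros b; ring.
    - intros a b; ring.
    - intros a.
      pose proof (normsq_ge0 (1 - 2 * a * x + x * x - y * y, 2 * y * (x - a))) as H.
      unfold normsq in H; simpl in H. lra.
    - replace (_ + _) with
        ((1 - x * x - y * y) * (1 - x * x - y * y) + 4 * (y * y)) by ring. nra. }
  replace (fst _) with ((1 - (x * x + y * y)) * F a1 a2).
  - apply Rmult_le_pos; lra.
  - unfold F, Csub, Cadd, Cmul, Copp, Cconj, C1; simpl. ring.
Qed.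

(** Now [(1 + z^2) conj (1 - z^2) = 1 - |z|^4 + 4 i x y], and again [1 - |z|^2] splits off. The
    parameters fill two opposite triangles; [F] takes [x] as an argument so that a reflection can
    exchange them. *)
Lemma phi_num_cross2 (a1 a2 : R) (z : CC) :
  -1 <= a1 <= 1 -> Rabs a1 >= Rabs a2 -> a1 * a2 >= 0 -> inE z ->
  0 <= fst (Cmul (Cmul (phi_num a1 z) (Cadd C1 (Cmul z z)))
                 (Cconj (Cmul (phi_num a2 z) (Csub C1 (Cmul z z))))).
Proof.
  intros H1 Habs Hsgn Hz%inE_normsq. destruct z as [x y]. rewrite !phi_num_pair.
  unfold normsq in Hz; simpl in Hz.
  pose (F := fun x a b => (1 + (x * x + y * y)) *
    ((1 - 2 * a * x + x * x - y * y) * (1 - 2 * b * x + x * x - y * y)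
    + 2 * y * (x - a) * (2 * y * (x - b))) + 8 * (x * (y * y)) * (a - b)).
  assert (HF : forall x a b, 0 <= b <= a -> a <= 1 -> 0 <= F x a b).
  { clear. intros x a b Hb Ha. apply (biaffine_ge0 (F x) 0); auto; try lra; unfold F.
    - clear; intros b; ring.
    - clear; intros a b; ring.
    - clear; intros a.
      pose proof (normsq_ge0 (1 - 2 * a * x + x * x - y * y, 2 * y * (x - a))) as H.
      unfold normsq in H; simpl in H.
      rewrite Rminus_diag, Rmult_0_r, Rplus_0_r. apply Rmult_le_pos; [nra | exact H].
    (* At the vertex [(1, 0)] the value is [|1 - z|^2 |z - i|^2 |z + i|^2]. *)
    - clear. replace (_ + _) with (((1 - x) * (1 - x) + y * y) *
        ((x * x + (1 - y) * (1 - y)) * (x * x + (1 + y) * (1 + y)))) by ring.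
      apply Rmult_le_pos; [exact (normsq_ge0 (1 - x, y))|].
      apply Rmult_le_pos; [exact (normsq_ge0 (x, 1 - y)) | exact (normsq_ge0 (x, 1 + y))]. }
  replace (fst _) with ((1 - (x * x + y * y)) * F x a1 a2).
  - apply Rmult_le_pos; [lra|].
    destruct (Rle_dec 0 a1) as [Hp | Hn].
    + rewrite (Rabs_pos_eq a1) in Habs by exact Hp.
      pose proof (Rle_abs a2). apply HF; [|lra]. split; [|lra].
      destruct (Rle_dec 0 a2); [assumption|]. rewrite Rabs_left in Habs by lra. nra.
    (* The reflection [z -> - conj z], with both parameters negated, preserves [F] and makes the
       parameters nonnegative. *)
    + replace (F x a1 a2) with (F (- x) (- a1) (- a2)) by (unfold F; ring).
      rewrite (Rabs_left a1) in Habs by lra.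
      pose proof (Rle_abs (- a2)) as H; rewrite Rabs_Ropp in H. apply HF; [|lra]. split; [|lra].
      destruct (Rle_dec a2 0); [lra|]. rewrite Rabs_pos_eq in Habs by lra. nra.
  - unfold F, Csub, Cadd, Cmul, Copp, Cconj, C1; simpl. ring.
Qed.

(** * Assembly of the two cases *)

Lemma phi_comb (a1 a2 t : R) (z : CC) :
  Cadd (Cscale t (phi a1 z)) (Cscale (1 - t) (phi a2 z)) = phi (t * a1 + (1 - t) * a2) z.
Proof.
  unfold phi, Cdiv. generalize (Cinv (Csub C1 (Cmul z z))). intros v.
  unfold Csub, Cadd, Cmul, Copp, Cscale, RtoC, C1; simpl. f_equal; ring.
Qed.

(** Analyticity and normalization pass to the combination by linearity; univalence and convexity
    come from the shear with parameter [t a1 + (1 - t) a2]. Only [|g'| < |h'|] is left to each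
    case. *)
Lemma comb_in_SH (a1 a2 t : R) (h1 g1 h1' g1' h2 g2 h2' g2' : CC -> CC) :
  -1 <= a1 <= 1 -> -1 <= a2 <= 1 -> 0 <= t <= 1 ->
  in_SH h1 g1 h1' g1' -> in_SH h2 g2 h2' g2' ->
  (forall z, inE z -> Cadd (h1 z) (g1 z) = phi a1 z) ->
  (forall z, inE z -> Cadd (h2 z) (g2 z) = phi a2 z) ->
  (forall z, inE z -> normsq (comb t g1' g2' z) < normsq (comb t h1' h2' z)) ->
  in_SH (comb t h1 h2) (comb t g1 g2) (comb t h1' h2') (comb t g1' g2') /\
  convex_imag (image_E (harm (comb t h1 h2) (comb t g1 g2))).
Proof.
  intros Ha1 Ha2 Ht (Hh1 & Hg1 & _ & _ & H01 & H11) (Hh2 & Hg2 & _ & _ & H02 & H12) S1 S2 Hlt.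
  assert (Ha : -1 <= t * a1 + (1 - t) * a2 <= 1) by nra.
  assert (Hh : analytic_on_E (comb t h1 h2) (comb t h1' h2'))
    by (intros z Hz; apply has_cderiv_comb; auto).
  assert (Hg : analytic_on_E (comb t g1 g2) (comb t g1' g2'))
    by (intros z Hz; apply has_cderiv_comb; auto).
  assert (S : forall z, inE z ->
    Cadd (comb t h1 h2 z) (comb t g1 g2 z) = phi (t * a1 + (1 - t) * a2) z).
  { intros z Hz. rewrite <- phi_comb, <- S1, <- S2 by exact Hz.
    unfold comb, Cadd, Cscale; simpl; f_equal; ring. }
  refine (conj (conj Hh (conj Hg (conj _ (conj _ (conj _ _))))) _).
  - now apply (shear_injective (t * a1 + (1 - t) * a2) _ _ (comb t h1' h2') (comb t g1' g2')).
  - intros z Hz. now apply dilatation_lt1, Hlt.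
  - transitivity (Cadd (Cscale t (harm h1 g1 C0)) (Cscale (1 - t) (harm h2 g2 C0))).
    + unfold harm, comb, Cadd, Cconj, Cscale; simpl; f_equal; ring.
    + rewrite H01, H02. unfold Cadd, Cscale, C0; simpl; f_equal; ring.
  - unfold comb. rewrite H11, H12. unfold Cadd, Cscale, C1; simpl; f_equal; ring.
  - now apply (shear_convex_imag (t * a1 + (1 - t) * a2) _ _ (comb t h1' h2') (comb t g1' g2')).
Qed.

(** Substituting [g' = omega h'] into the derivative of [h + g = phi a] determines [h']; the formula
    is kept multiplied out. *)
Lemma in_SH_deriv_eq (a : R) (h g h' g' omega : CC -> CC) (z : CC) :
  in_SH h g h' g' -> (forall z, inE z -> Cadd (h z) (g z) = phi a z) -> inE z ->
  dilatation h' g' z = omega z ->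
  h' z <> C0 /\ g' z = Cmul (omega z) (h' z) /\
  Cmul (h' z) (Cmul (Cadd C1 (omega z))
    (Cmul (Csub C1 (Cmul z z)) (Csub C1 (Cmul z z)))) = phi_num a z.
Proof.
  intros (Hh & Hg & _ & Hd & _) Hs Hz Ho. destruct (Hd z Hz) as [H0 _].
  assert (Eg : g' z = Cmul (omega z) (h' z)) by now apply dilatation_eq.
  split; [exact H0|]. split; [exact Eg|].
  rewrite <- (phi_deriv a h g h' g' z Hh Hg Hs Hz), Eg. ring.
Qed.

Theorem theorem2p9 :
  forall (a1 a2 t : R) (h1 g1 h1' g1' h2 g2 h2' g2' : CC -> CC),
    -1 <= a1 <= 1 -> -1 <= a2 <= 1 ->
    in_SH h1 g1 h1' g1' -> in_SH h2 g2 h2' g2' ->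
    (forall z, inE z -> Cadd (h1 z) (g1 z) = phi a1 z) ->
    (forall z, inE z -> Cadd (h2 z) (g2 z) = phi a2 z) ->
    (forall z, inE z -> dilatation h1' g1' z = Copp z) ->
    0 <= t <= 1 ->
    ( (forall z, inE z -> dilatation h2' g2' z = Copp (Cmul z z)) ->
      a1 >= a2 ->
      in_SH (comb t h1 h2) (comb t g1 g2) (comb t h1' h2') (comb t g1' g2') /\
      convex_imag (image_E (harm (comb t h1 h2) (comb t g1 g2))) ) /\
    ( (forall z, inE z -> dilatation h2' g2' z = Cmul z z) ->
      Rabs a1 >= Rabs a2 -> a1 * a2 >= 0 ->
      in_SH (comb t h1 h2) (comb t g1 g2) (comb t h1' h2') (comb t g1' g2') /\
      convex_imag (image_E (harm (comb t h1 h2) (comb t g1 g2))) ).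
Proof.
  intros a1 a2 t h1 g1 h1' g1' h2 g2 h2' g2' Ha1 Ha2 F1 F2 S1 S2 O1 Ht.
  split.
  - intros O2 Ha. apply (comb_in_SH a1 a2); auto. intros z Hz.
    destruct (in_SH_deriv_eq a1 h1 g1 h1' g1' Copp z F1 S1 Hz (O1 z Hz)) as (Hp1 & E1 & N1).
    destruct (in_SH_deriv_eq a2 h2 g2 h2' g2' (fun z => Copp (Cmul z z)) z F2 S2 Hz (O2 z Hz))
      as (Hp2 & E2 & N2).
    replace (normsq (comb t g1' g2' z)) with
      (normsq (Cmul z (Cadd (Cscale t (h1' z)) (Cscale (1 - t) (Cmul z (h2' z)))))).
    2:{ unfold comb. rewrite E1, E2. unfold normsq, Cadd, Cscale, Copp, Cmul; simpl. ring. }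
    apply combined_dilatation_lt1; auto.
    (* The denominators of [h1'] and [h2'] are [(1 - z) (1 - z^2)^2] and [(1 - z^2)^3]. The factors
       [1 + z] and [1 - z] turn them into [(1 - z^2)^3] and [(1 - z^2)^3 (1 - z)], whose quotient is
       [1 - b] for [b = z]. *)
    eapply (cross_term_ge0 _ _ _ _ (Cadd C1 z) (Csub C1 z));
      [ | | rewrite N1, N2; apply phi_num_cross1; auto; lra].
    + replace (Cmul (Cmul (Cadd C1 (Copp z)) (Cmul (Csub C1 (Cmul z z)) (Csub C1 (Cmul z z))))
        (Cadd C1 z)) with (Cmul (Csub C1 (Cmul z z))
          (Cmul (Csub C1 (Cmul z z)) (Csub C1 (Cmul z z)))) by ring.
      repeat apply Cmul_neq0; now apply one_sub_neq0, inE_Cmul.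
    + ring.
  - intros O2 Habs Hsgn. apply (comb_in_SH a1 a2); auto. intros z Hz.
    destruct (in_SH_deriv_eq a1 h1 g1 h1' g1' Copp z F1 S1 Hz (O1 z Hz)) as (Hp1 & E1 & N1).
    destruct (in_SH_deriv_eq a2 h2 g2 h2' g2' (fun z => Cmul z z) z F2 S2 Hz (O2 z Hz))
      as (Hp2 & E2 & N2).
    replace (normsq (comb t g1' g2' z)) with
      (normsq (Cmul z (Cadd (Cscale t (h1' z)) (Cscale (1 - t) (Cmul (Copp z) (h2' z)))))).
    2:{ unfold comb. rewrite E1, E2. unfold normsq, Cadd, Cscale, Copp, Cmul; simpl. ring. }
    apply combined_dilatation_lt1; auto; [now apply inE_Copp|].
    (* The second denominator is now [(1 + z^2) (1 - z^2)^2]. With the factors [1 + z^2] and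
       [1 - z^2] the two products differ by [1 + z], which is [1 - b] for [b = - z]. *)
    eapply (cross_term_ge0 _ _ _ _ (Cadd C1 (Cmul z z)) (Csub C1 (Cmul z z)));
      [ | | rewrite N1, N2; now apply phi_num_cross2].
    + replace (Cadd C1 (Cmul z z)) with (Csub C1 (Copp (Cmul z z))) by ring.
      repeat apply Cmul_neq0; try now apply one_sub_neq0, inE_Cmul.
      * now apply one_sub_neq0.
      * now apply one_sub_neq0, inE_Copp, inE_Cmul.
    + ring.
Qed.
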